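(* For all positive integers $m$ and $d$, \[ \mathsf{s}_{2m}(\mathbb{Z}_2^d) = 1 + \max_{1 \leq j \leq m} \left\{ \beta_{\{2j, 2j+2, \ldots, 2m\}}(d) + (2m-2j) \right\}. \]
   Context: $\mathsf{s}_{2m}(\mathbb{Z}_2^d)$ denotes the smallest integer $s$ such that every sequence (repetitions allowed) of length $s$ of elements of $\mathbb{Z}_2^d$ has a subsequence of length $2m$ whose elements sum to $0$. For a set $W$ of positive integers containing at least one even number, $\beta_W(d)$ denotes the largest size of a set $A \subseteq \mathbb{Z}_2^d$ (of distinct elements) which has no subset $B \subseteq A$ with $|B| \in W$ and $\sum_{x\in B} x = 0$. *)

(* Defs.v *)
From mathcomp Require Import all_boot all_order all_algebra.

Set Implicit Arguments.
Unset Strict Implicit.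
Unset Printing Implicit Defensive.

Import GRing.Theory.

Notation Z2pow d := ('rV['Z_2]_d).

Definition has_zero_sum_subseq (k d : nat) (t : seq (Z2pow d)) : bool :=
  [exists u : k.-tuple (Z2pow d), subseq u t && (\sum_(x <- u) x == 0)%R].

Definition forces_zero_sum (k d n : nat) : bool :=
  [forall t : n.-tuple (Z2pow d), has_zero_sum_subseq k t].

Lemma sum_count_mem_size (T : finType) (t : seq T) :
  \sum_(x : T) count_mem x t = size t.
Proof.
rewrite -sum1_size [RHS](partition_big id predT) //=.
by apply: eq_bigr => x _; rewrite sum1_count.
Qed.

Lemma frequent_value (T : finType) (x0 : T) (k : nat) (t : seq T) :
  size t = #|T| * k -> exists x : T, k <= count_mem x t.
Proof.
move=> size_t; apply/existsP; apply: contraT; rewrite negb_exists => /forallP hlt.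
have : \sum_(x : T) (count_mem x t).+1 <= \sum_(x : T) k.
  by apply: leq_sum => x _; rewrite ltnNge hlt.
under eq_bigr do rewrite -addn1.
rewrite big_split /= sum_count_mem_size size_t !sum_nat_const muln1.
rewrite -[X in _ <= X]addn0 leq_add2l leqn0 => /eqP card0.
by have := fintype0 x0 card0.
Qed.

(* Only even lengths are considered: for odd k no n forces a zero sum when
   0 < d (take a constant sequence with a nonzero value). *)
Lemma forces_zero_sum_exists (m d : nat) :
  exists n, forces_zero_sum (2 * m) d n.
Proof.
exists (#|{: Z2pow d}| * (2 * m)); apply/forallP => t.
have [x hx] := frequent_value (0%R : Z2pow d) (size_tuple t).
apply/existsP; exists (nseq_tuple (2 * m) x); apply/andP; split.
  apply: subseq_trans (filter_subseq (pred1 x) t).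
  have /all_pred1P -> : all (pred1 x) (filter (pred1 x) t) := filter_all _ _.
  by rewrite size_filter -(subnKC hx) nseqD prefix_subseq.
rewrite big_nseq -Monoid.iteropE /= -/(GRing.natmul x (2 * m)).
have x2 : (x *+ 2 = 0)%R.
  rewrite mulr2n; apply/rowP => i; rewrite !mxE; apply: val_inj.
  by case: (x _ i) => [[|[|]]].
by rewrite mulrnA x2 mul0rn.
Qed.

(* The constant s_{2m}(Z_2^d): the index is m, the subsequences have length 2m. *)
Definition s_even (m d : nat) : nat := ex_minn (forces_zero_sum_exists m d).

Definition zero_sum_free (W : {pred nat}) (d : nat) (A : {set Z2pow d}) : bool :=
  [forall B : {set Z2pow d},
     (B \subset A) && (#|B| \in W) ==> (\sum_(x in B) x != 0)%R].

(* For 0 \notin W the empty set is zero-sum free, so the maximum is attained. *)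
Definition beta (W : {pred nat}) (d : nat) : nat :=
  \max_(A : {set Z2pow d} | zero_sum_free W A) #|A|.

Definition even_between (a b : nat) : {pred nat} :=
  [pred w | ~~ odd w & a <= w <= b].

(* Main.v *)
Require Import Defs.
From mathcomp Require Import all_boot all_order all_algebra.
From mathcomp Require Import zify.

(** A sequence over [Z_2^d] is, up to order, [s ++ r ++ r] with [s] duplicate-free,
    and its sum is that of [s].  If it has no zero-sum subsequence of length [2m]
    then [size r < m], and with [j = m - size r] the set [s] contains no zero-sum
    subset of even size between [2j] and [2m]: such a subset could be completed to
    length [2m] by pairs from [r].  Conversely, an extremal set [A] for [2j..2m]
    together with [2m - 2j] further copies of one of its elements has no zero-sum
    subsequence of length [2m]. *)

Import GRing.Theory.

Lemma perm_uniq_cat_pairs (T : eqType) (t : seq T) :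
  exists s r : seq T, uniq s /\ perm_eq t (s ++ r ++ r).
Proof.
elim: t => [|x t [s [r [uniq_s perm_t]]]]; first by exists [::], [::].
have [xs|xNs] := boolP (x \in s); last first.
  by exists (x :: s), r; split; rewrite /= ?xNs ?perm_cons.
(* The new [x] meets its copy in [s]; both leave [s] and become one pair in [r]. *)
exists (rem x s), (x :: r); split; first exact: rem_uniq.
apply/permP => a; have := permP perm_t a; have := permP (perm_to_rem xs) a.
by rewrite /= !count_cat /= !count_cat /= => -> ->; lia.
Qed.

Lemma addrr_Z2pow (d : nat) (x : Z2pow d) : (x + x = 0)%R.
Proof.
apply/rowP => i; rewrite !mxE; apply: val_inj.
by case: (x _ i) => [[|[|]]].
Qed.

Lemma big_cat_pairs (d : nat) (s r : seq (Z2pow d)) :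
  (\sum_(x <- s ++ r ++ r) x = \sum_(x <- s) x)%R.
Proof. by rewrite !big_cat /= addrr_Z2pow addr0. Qed.

Lemma sum_in_set_uniq (d : nat) (s : seq (Z2pow d)) :
  uniq s -> (\sum_(x in [set x in s]) x = \sum_(x <- s) x)%R.
Proof. by move=> us; rewrite (big_uniq _ us); apply: eq_bigl => x; rewrite inE. Qed.

(** Sums ignore order, so a subsequence matters only up to permutation, that is, through its
    multiplicities. *)
Lemma has_zero_sum_subseqP (k d : nat) (t : seq (Z2pow d)) :
  reflect (exists u : seq (Z2pow d),
             [/\ size u = k, (\sum_(x <- u) x = 0)%R
               & forall x, count_mem x u <= count_mem x t])
          (has_zero_sum_subseq k t).
Proof.
apply: (iffP existsP) => [[u /andP[sub_ut /eqP u0]]|[u [size_u u0 /count_subseqP]]].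
  exists u; split; rewrite ?size_tuple // => x; exact: leq_count_subseq.
case=> v sub_vt perm_uv.
have size_v : size v == k by rewrite -(perm_size perm_uv) size_u.
exists (Tuple size_v); by rewrite /= sub_vt -(perm_big _ perm_uv) /= u0 eqxx.
Qed.

Lemma size_no_zero_sum_subseq (m d : nat) (t : seq (Z2pow d)) :
  ~~ has_zero_sum_subseq (2 * m) t ->
  exists2 j, 1 <= j <= m
    & size t <= beta (even_between (2 * j) (2 * m)) d + (2 * m - 2 * j).
Proof.
move=> no_t; have [s [r [uniq_s perm_t]]] := perm_uniq_cat_pairs _ t.
have count_t x : count_mem x t = count_mem x s + (count_mem x r + count_mem x r).
  by rewrite (permP perm_t) !count_cat.
have no_set (B : {set Z2pow d}) b : B \subset [set x in s] -> #|B| = 2 * b ->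
    b <= m -> m - b <= size r -> (\sum_(x in B) x != 0)%R.
  move=> /subsetP sBs cardB le_bm le_r; apply: contra no_t => /eqP B0.
  apply/has_zero_sum_subseqP.
  exists (enum B ++ take (m - b) r ++ take (m - b) r); split.
  - by rewrite !size_cat -cardE cardB size_takel //; lia.
  - by rewrite big_cat_pairs big_enum.
  - move=> x; rewrite count_t !count_cat.
    have le_take := leq_count_subseq (pred1 x) (take_subseq r (m - b)).
    suff : count_mem x (enum B) <= count_mem x s by lia.
    rewrite !count_uniq_mem ?enum_uniq // mem_enum.
    by case xB: (x \in B) => //; have := sBs x xB; rewrite inE => ->.
(* Otherwise [m] pairs from [r] alone have length [2 * m] and sum zero: this is [no_set] for the
   empty set. *)
have lt_rm : size r < m.
  rewrite ltnNge; apply/negP => le_mr.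
  have := no_set set0 0; rewrite sub0set cards0 subn0 big_set0 eqxx.
  by move=> /(_ isT erefl isT le_mr).
(* With this [j], the condition [m - b <= size r] of [no_set] reads [j <= b], and [2 * m - 2 * j] is
   the length of [r ++ r]. *)
exists (m - size r); first lia.
have free_s : zero_sum_free (even_between (2 * (m - size r)) (2 * m)) [set x in s].
  apply/forallP => B; apply/implyP => /and3P[sBs evenB /andP[geB leB]].
  have [b cardB] : exists b, #|B| = 2 * b by exists #|B|./2; rewrite mul2n even_halfK.
  by move: geB leB; rewrite cardB => geB leB; apply: (no_set B b) => //; lia.
have le_beta : #|[set x in s]| <= beta (even_between (2 * (m - size r)) (2 * m)) d.
  exact: (@leq_bigmax_cond _ _ (fun A : {set Z2pow d} => #|A|)).
rewrite cardsE (card_uniqP uniq_s) in le_beta.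
by rewrite (perm_size perm_t) !size_cat; apply: leq_add; [exact: le_beta | lia].
Qed.

(** Only [a] can repeat, so the pairs of a zero-sum [u] are copies of [a]. Removing them leaves a
    zero-sum subset of [A] whose even size lies in the forbidden range. *)
Lemma no_zero_sum_subseq_extension (m j d : nat) (A : {set Z2pow d}) (a : Z2pow d) :
  a \in A -> zero_sum_free (even_between (2 * j) (2 * m)) A -> j <= m ->
  ~~ has_zero_sum_subseq (2 * m) (enum A ++ nseq (2 * m - 2 * j) a).
Proof.
move=> aA /forallP freeA le_jm; apply/negP => /has_zero_sum_subseqP[u [size_u u0 le_u]].
have [s [r [uniq_s perm_u]]] := perm_uniq_cat_pairs _ u.
have le_count x : count_mem x s + (count_mem x r + count_mem x r)
    <= (x \in A) + (a == x) * (2 * m - 2 * j).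
  move: (le_u x); rewrite (permP perm_u) !count_cat count_nseq.
  by rewrite (count_uniq_mem _ (enum_uniq _)) mem_enum.
have sub_sA : [set x in s] \subset A.
  apply/subsetP => x; rewrite inE => xs.
  have := le_count x; rewrite (count_uniq_mem _ uniq_s) xs.
  by case: eqP => [<- //|_]; case: (x \in A) => //; lia.
have r_a : all (pred1 a) r.
  apply/allP => x xr /=; rewrite eq_sym; apply/negPn/negP => /negbTE ax.
  have := le_count x; rewrite ax.
  have : 0 < count_mem x r by rewrite -has_count has_pred1.
  by case: (x \in A); lia.
(* There are [2 * m - 2 * j + 1] copies of [a], counting the one in [A]; parity discards the odd
   one. *)
have le_r : 2 * size r <= 2 * m - 2 * j.
  have := le_count a; rewrite eqxx aA mul1n.
  by move: r_a; rewrite all_count => /eqP ->; lia.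
have size_sr : size s + 2 * size r = 2 * m.
  by rewrite -size_u (perm_size perm_u) !size_cat mul2n addnn.
have size_s : #|[set x in s]| = 2 * m - 2 * size r.
  by rewrite cardsE (card_uniqP uniq_s) -size_sr addnK.
have /implyP := freeA [set x in s].
rewrite sub_sA inE size_s sum_in_set_uniq // -(big_cat_pairs _ s r).
rewrite -(perm_big _ perm_u) u0 eqxx => absurd.
by suff : false by []; apply: absurd; lia.
Qed.

Lemma forces_zero_sum_lower_bound (m j d n : nat) (hj : 0 < j <= m) :
  forces_zero_sum (2 * m) d n ->
  beta (even_between (2 * j) (2 * m)) d + (2 * m - 2 * j) < n.
Proof.
move=> /forallP forces_n.
have has_take (t : seq (Z2pow d)) : n <= size t -> has_zero_sum_subseq (2 * m) t.
  move=> le_nt; have size_take : size (take n t) == n by rewrite size_takel.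
  have /has_zero_sum_subseqP[u [size_u u0 le_u]] := forces_n (Tuple size_take).
  apply/has_zero_sum_subseqP; exists u; split=> // x.
  exact: leq_trans (le_u x) (leq_count_subseq _ (take_subseq t n)).
(* The zero sequence of length [n] must contain a subsequence of length [2 * m]. With [0 < j] this
   keeps the subtraction below from truncating. *)
have le_mn : 2 * m <= n.
  have := has_take (nseq n 0%R); rewrite size_nseq => /(_ (leqnn n)).
  by case/existsP=> u /andP[/size_subseq]; rewrite size_tuple size_nseq.
suff : beta (even_between (2 * j) (2 * m)) d <= n.-1 - (2 * m - 2 * j) by lia.
(* An empty [A] has no element to repeat, but its bound is trivial. *)
apply/bigmax_leqP => A freeA; have [->|[a aA]] := set_0Vmem A; first by rewrite cards0.
have /negP no_ext := no_zero_sum_subseq_extension _ _ _ _ _ aA freeA (proj2 (andP hj)).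
suff : ~~ (n <= #|A| + (2 * m - 2 * j)) by lia.
by apply/negP => le_n; apply/no_ext/has_take; rewrite size_cat -cardE size_nseq.
Qed.

Theorem theorem6 (m d : nat) (hm : 0 < m) (hd : 0 < d) :
  s_even m d
  = 1 + \max_(1 <= j < m.+1)
          (beta (even_between (2 * j) (2 * m)) d + (2 * m - 2 * j)).
Proof.
rewrite /s_even; case: ex_minnP => n forces_n min_n; apply/eqP; rewrite eqn_leq.
apply/andP; split.
  (* By minimality it suffices that length [1 + max] forces a zero sum: a counterexample would be no
     longer than one of the terms of the maximum. *)
  apply: min_n; apply/forallP => t; apply: contraT => /size_no_zero_sum_subseq[j hj].
  rewrite size_tuple add1n; apply: contraLR => _; rewrite -leqNgt.
  by apply: (@leq_bigmax_seq _ _ _ _ j) => //; rewrite mem_index_iota ltnS.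
have n_gt0 : 0 < n.
  by apply: leq_ltn_trans (forces_zero_sum_lower_bound m m d n _ forces_n); rewrite ?hm /=.
rewrite add1n -(prednK n_gt0) ltnS; apply/bigmax_leqP_seq => j.
rewrite mem_index_iota ltnS => hj _; rewrite -ltnS (prednK n_gt0).
exact: forces_zero_sum_lower_bound.
Qed.
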